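(* Consider an electrical circuit satisfying the soundness and passivity assumptions, with incidence matrices $A_C,A_R,A_L,A_V,A_I$, charge function $q$, flux function $\phi$, conductance function $g$, and sources $\imath(t)$, $v(t)$. Let $V_C,V_L$ be the energy functions of $q,\phi$. Then the following holds: (a) The circuit model $$\frac{d}{dt}\begin{pmatrix}A_C&0&0&0\\0&I&0&0\\0&0&0&0\\0&0&0&0\end{pmatrix}\begin{pmatrix}q_C\\ \phi_L\\ e\\ \jmath_V\end{pmatrix}=\begin{pmatrix}0&-A_L&0&-A_V\\ A_L^\top&0&0&0\\0&0&0&0\\ A_V^\top&0&0&0\end{pmatrix}\begin{pmatrix}e\\ \phi^{-1}(\phi_L)\\ q^{-1}(q_C)\\ \jmath_V\end{pmatrix}-\begin{pmatrix}A_Rg(A_R^\top e)\\0\\ A_C^\top e-q^{-1}(q_C)\\0\end{pmatrix}+\begin{pmatrix}-A_I&0\\0&0\\0&0\\0&-I\end{pmatrix}\begin{pmatrix}\imath(t)\\ v(t)\end{pmatrix},$$ $$y=\begin{pmatrix}-A_I^\top e\\-\jmath_V\end{pmatrix}$$ is a PH-DAE with $$u=\begin{pmatrix}\imath\\ v\end{pmatrix},\quad x=\begin{pmatrix}q_C\\ \phi_L\\ e\\ \jmath_V\end{pmatrix},\quad z(x)=\begin{pmatrix}e\\ \jmath_L\\ u_C\\ \jmath_V\end{pmatrix}=\begin{pmatrix}e\\ \phi^{-1}(\phi_L)\\ q^{-1}(q_C)\\ \jmath_V\end{pmatrix},\quad r\begin{pmatrix}e\\ \jmath_L\\ u_C\\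 \jmath_V\end{pmatrix}=\begin{pmatrix}A_Rg(A_R^\top e)\\0\\ A_C^\top e-u_C\\0\end{pmatrix},$$ $$E=\begin{pmatrix}A_C&0&0&0\\0&I&0&0\\0&0&0&0\\0&0&0&0\end{pmatrix},\quad J=\begin{pmatrix}0&-A_L&0&-A_V\\ A_L^\top&0&0&0\\0&0&0&0\\ A_V^\top&0&0&0\end{pmatrix},\quad B=\begin{pmatrix}-A_I&0\\0&0\\0&0\\0&-I\end{pmatrix},$$ subspace $\mathcal V=\{(e^\top,\jmath_L^\top,u_C^\top,\jmath_V^\top)^\top : A_C^\top e=u_C\}$, and Hamiltonian $H(x)=V_C(q_C)+V_L(\phi_L)$. (b) The circuit model $$\frac{d}{dt}\begin{pmatrix}0&0&0&0&0\\0&0&0&0&0\\0&0&I&0&0\\0&0&0&I&0\\0&0&0&0&0\end{pmatrix}\begin{pmatrix}e\\ \jmath_C\\ q_C\\ \phi_L\\ \jmath_V\end{pmatrix}=\begin{pmatrix}0&-A_C&0&-A_L&-A_V\\ A_C^\top&0&-I&0&0\\0&I&0&0&0\\ A_L^\top&0&0&0&0\\ A_V^\top&0&0&0&0\end{pmatrix}\begin{pmatrix}e\\ \jmath_C\\ q^{-1}(q_C)\\ \phi^{-1}(\phi_L)\\ \jmath_V\end{pmatrix}-\begin{pmatrix}A_Rg(A_R^\top e)\\0\\0\\0\\0\end{pmatrix}+\begin{pmatrix}-A_I&0\\0&0\\0&0\\0&0\\0&-I\end{pmatrix}\begin{pmatrix}\imath(t)\\ v(t)\end{pmatrix},$$ $$y=\begin{pmatrix}-A_I^\top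 e\\-\jmath_V\end{pmatrix}$$ is a PH-DAE with $u=(\imath^\top,v^\top)^\top$, $$x=\begin{pmatrix}e\\ \jmath_C\\ q_C\\ \phi_L\\ \jmath_V\end{pmatrix},\quad z(x)=\begin{pmatrix}e\\ \jmath_C\\ u_C\\ \jmath_L\\ \jmath_V\end{pmatrix}=\begin{pmatrix}e\\ \jmath_C\\ q^{-1}(q_C)\\ \phi^{-1}(\phi_L)\\ \jmath_V\end{pmatrix},\quad r\begin{pmatrix}e\\ \jmath_C\\ u_C\\ \jmath_L\\ \jmath_V\end{pmatrix}=\begin{pmatrix}A_Rg(A_R^\top e)\\0\\0\\0\\0\end{pmatrix},$$ $E$, $J$, $B$ the three constant matrices displayed in the model (multiplying $x$, $z(x)$ and $u$, respectively), subspace $\mathcal V=\mathbb{R}^{n_v}\times\mathbb{R}^{n_C}\times\mathbb{R}^{n_C}\times\mathbb{R}^{n_L}\times\mathbb{R}^{n_V}$, where $n_v$ is the number of non-grounded vertices, and Hamiltonian $H(x)=V_C(q_C)+V_L(\phi_L)$.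
   Context: PH-DAE. A system $\frac{d}{dt}Ex(t)=Jz(x(t))-r(z(x(t)))+Bu(t)$, $y(t)=B^\top z(x(t))$ with $E\in\mathbb{R}^{p\times n}$, $J\in\mathbb{R}^{p\times p}$, $B\in\mathbb{R}^{p\times m}$, $z:\mathbb{R}^n\to\mathbb{R}^p$, $r:\mathbb{R}^p\to\mathbb{R}^p$ is a port-Hamiltonian DAE (PH-DAE) with subspace $\mathcal V\subset\mathbb{R}^p$ and Hamiltonian $H\in C^1(\mathbb{R}^n,\mathbb{R})$ if: (i) for all intervals $\mathcal I$ and all $u:\mathcal I\to\mathbb{R}^m$ for which the system has a solution $x:\mathcal I\to\mathbb{R}^n$, $z(x(t))\in\mathcal V$ for all $t\in\mathcal I$; (ii) $v^\top Jw=-w^\top Jv$ for all $v,w\in\mathcal V$; (iii) $v^\top r(v)\ge0$ for all $v\in\mathcal V$; (iv) $\nabla H(x)=E^\top z(x)$ for all $x\in z^{-1}(\mathcal V)$. A solution is a function $x$ with $Ex$ differentiable satisfying the equation pointwise. Circuit. The circuit is a finite loop-free directed graph whose edges are capacitances, resistances, inductances, voltage sources and current sources ($n_C,n_R,n_L,n_V,n_I$ many). The all-vertex incidence matrix has entry $1$ if edge $k$ starts at vertex $j$, $-1$ if it ends there, $0$ otherwise; deleting the row of one (grounded) vertex and sorting columns by component type gives $(A_C\,A_R\,A_L\,A_I\,A_V)$ with $n_v$ rows. The unknowns are vertex potentials $e$, charges $q_C$, fluxes $\phi_L$, currents $\jmath_V$ through voltage sources, and in (b) also capacitive currents $\jmath_C$.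 Soundness assumption: the graph has at least one edge and is connected; it contains no cycle consisting only of voltage source edges and no cut consisting only of current source edges (equivalently, $A_V$ and $(A_C\,A_R\,A_L\,A_V)^\top$ have full column rank). Passivity assumption: (1) $q:\mathbb{R}^{n_C}\to\mathbb{R}^{n_C}$ and $\phi:\mathbb{R}^{n_L}\to\mathbb{R}^{n_L}$ are bijective, continuously differentiable, and their Jacobians are symmetric and positive definite everywhere; (2) $g:\mathbb{R}^{n_R}\to\mathbb{R}^{n_R}$ is continuously differentiable and $\frac{\partial g}{\partial u_R}(u_R)+\frac{\partial g}{\partial u_R}(u_R)^\top$ is positive definite for all $u_R\in\mathbb{R}^{n_R}$. Energy functions: $V_C:\mathbb{R}^{n_C}\to\mathbb{R}$ and $V_L:\mathbb{R}^{n_L}\to\mathbb{R}$ are twice continuously differentiable, strictly convex, satisfy $\nabla V_C=q^{-1}$ and $\nabla V_L=\phi^{-1}$, and are positive everywhere except at one point each (such functions exist under the passivity assumption).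
   Formalization: The formal statement adds the assumption g(0)=0 (zero voltage gives zero resistive current); without it the claim fails, e.g. for one resistance with g(u)=u-1, where v^T r(v) is negative at u=1/2. *)

(* Defs.v *)
(* MathComp-Analysis; the reals are an arbitrary [R : realType]. *)
From HB Require Import structures.
From mathcomp Require Export all_boot all_order all_algebra.
From mathcomp Require Export all_classical all_reals all_analysis.
Export Order.TTheory GRing.Theory Num.Theory.
Export numFieldNormedType.Exports.

Set Implicit Arguments.
Unset Strict Implicit.
Unset Printing Implicit Defensive.

Local Open Scope classical_set_scope.
Local Open Scope ring_scope.

Definition jac {R : realType} {m n : nat} (f : 'cV[R]_n -> 'cV[R]_m)
    (x : 'cV[R]_n) : 'M[R]_(m, n) :=
  \matrix_(i < m, j < n) ('D_(delta_mx j 0) f x) i 0.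

Definition grad {R : realType} {n : nat} (f : 'cV[R]_n -> R)
    (x : 'cV[R]_n) : 'cV[R]_n :=
  \col_(j < n) 'D_(delta_mx j 0) (f : 'cV[R]_n -> R^o) x.

Definition C1_map {R : realType} {m n : nat} (f : 'cV[R]_n -> 'cV[R]_m) : Prop :=
  (forall x, differentiable f x) /\ continuous (jac f).

Definition C1_fun {R : realType} {n : nat} (f : 'cV[R]_n -> R) : Prop :=
  (forall x, differentiable (f : 'cV[R]_n -> R^o) x) /\ continuous (grad f).

Definition C2_fun {R : realType} {n : nat} (f : 'cV[R]_n -> R) : Prop :=
  C1_fun f /\ C1_map (grad f).

Definition strictly_convex {R : realType} {n : nat} (f : 'cV[R]_n -> R) : Prop :=
  forall (x y : 'cV[R]_n) (t : R), x != y -> 0 < t < 1 ->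
    f (t *: x + (1 - t) *: y) < t * f x + (1 - t) * f y.

(* Symmetry is not part of this notion. *)
Definition posdef {R : realType} {n : nat} (M : 'M[R]_n) : Prop :=
  forall v : 'cV[R]_n, v != 0 -> 0 < (v^T *m M *m v) 0 0.

(* Meaningful only for bijective [f]; total otherwise. *)
Definition inv_map {R : realType} {n : nat} (f : 'cV[R]_n -> 'cV[R]_n) :
    'cV[R]_n -> 'cV[R]_n :=
  pinv [set: 'cV[R]_n] f.

(* A one-point interval is excluded: there is no derivative on it. *)
Definition time_interval {R : realType} (I : set R) : Prop :=
  is_interval I /\ exists a b : R, [/\ I a, I b & a < b].

(* Functions on [I] are represented by functions on [R]; only their values on
   [I] matter, and the derivative is one-sided at an endpoint lying in [I]. *)
Definition has_deriv_on {R : realType} {p : nat} (I : set R)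
    (f : R -> 'cV[R]_p) (t : R) (l : 'cV[R]_p) : Prop :=
  (s - t)^-1 *: (f s - f t) @[s --> within I t^'] --> l.

Definition dae_solution {R : realType} {p n m : nat}
    (E : 'M[R]_(p, n)) (J : 'M[R]_p) (B : 'M[R]_(p, m))
    (z : 'cV[R]_n -> 'cV[R]_p) (r : 'cV[R]_p -> 'cV[R]_p)
    (I : set R) (u : R -> 'cV[R]_m) (x : R -> 'cV[R]_n) : Prop :=
  forall t, I t ->
    has_deriv_on I (fun s => E *m x s) t (J *m z (x t) - r (z (x t)) + B *m u t).

Definition dae_output {R : realType} {p n m : nat} (B : 'M[R]_(p, m))
    (z : 'cV[R]_n -> 'cV[R]_p)
    (I : set R) (x : R -> 'cV[R]_n) (y : R -> 'cV[R]_m) : Prop :=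
  forall t, I t -> y t = B^T *m z (x t).

Definition is_PHDAE {R : realType} {p n m : nat}
    (E : 'M[R]_(p, n)) (J : 'M[R]_p) (B : 'M[R]_(p, m))
    (z : 'cV[R]_n -> 'cV[R]_p) (r : 'cV[R]_p -> 'cV[R]_p)
    (V : set 'cV[R]_p) (H : 'cV[R]_n -> R) : Prop :=
  (GRing.submod_closed [in V] /\ C1_fun H) /\
  [/\ forall (I : set R) (u : R -> 'cV[R]_m) (x : R -> 'cV[R]_n),
        time_interval I -> dae_solution E J B z r I u x ->
        forall t, I t -> V (z (x t)),
      forall v w, V v -> V w -> v^T *m J *m w = - (w^T *m J *m v),
      forall v, V v -> 0 <= (v^T *m r v) 0 0
    & forall x, V (z x) -> grad H x = E^T *m z x].

Definition circuit_edge (nC nR nL nV nI : nat) : finType :=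
  ('I_nC + 'I_nR + 'I_nL + 'I_nV + 'I_nI)%type.

Record circuit (nv nC nR nL nV nI : nat) := Circuit {
  edge_src : circuit_edge nC nR nL nV nI -> 'I_nv.+1;
  edge_tgt : circuit_edge nC nR nL nV nI -> 'I_nv.+1;
  loop_free : forall k, edge_src k != edge_tgt k;
  ground : 'I_nv.+1 }.

Section Circuit.
Variables (nv nC nR nL nV nI : nat).
Local Notation edge := (circuit_edge nC nR nL nV nI).
Local Notation vertex := 'I_nv.+1.

Definition edgeC (k : 'I_nC) : edge := inl (inl (inl (inl k))).
Definition edgeR (k : 'I_nR) : edge := inl (inl (inl (inr k))).
Definition edgeL (k : 'I_nL) : edge := inl (inl (inr k)).
Definition edgeV (k : 'I_nV) : edge := inl (inr k).
Definition edgeI (k : 'I_nI) : edge := inr k.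

Definition voltage_source (k : edge) : bool :=
  if k is inl (inr _) then true else false.
Definition current_source (k : edge) : bool :=
  if k is inr _ then true else false.

Variable G : circuit nv nC nR nL nV nI.

Definition adjacent (i j : vertex) : bool :=
  [exists k : edge, ((edge_src G k == i) && (edge_tgt G k == j))
                 || ((edge_src G k == j) && (edge_tgt G k == i))].

Definition graph_connected : Prop := forall i j : vertex, connect adjacent i j.

(* A step [(k, b)] traverses the edge [k] along its direction if [b] is true,
   and against it otherwise. *)
Definition step_start (s : edge * bool) : vertex :=
  if s.2 then edge_src G s.1 else edge_tgt G s.1.
Definition step_end (s : edge * bool) : vertex :=
  if s.2 then edge_tgt G s.1 else edge_src G s.1.

(* Edge distinctness only matters for cycles of length two, which in a
   multigraph consist of two parallel edges. *)
Definition is_graph_cycle (c : seq (edge * bool)) : Prop :=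
  [/\ c != [::], cycle (fun s s' => step_end s == step_start s') c,
      uniq (map step_start c) & uniq (map fst c)].

Definition cut_edges (S : {set vertex}) : {set edge} :=
  [set k | (edge_src G k \in S) != (edge_tgt G k \in S)]%SET.

Definition sound : Prop :=
  [/\ exists k : edge, True,
      graph_connected,
      forall c, is_graph_cycle c -> ~ (forall s, s \in c -> voltage_source s.1)
    & forall S : {set vertex}, S != finset.set0 -> S != [set: vertex]%SET ->
        ~ (forall k, k \in cut_edges S -> current_source k)].

Definition full_incidence (R : realType) (m : nat) (c : 'I_m -> edge) :
    'M[R]_(nv.+1, m) :=
  \matrix_(j < nv.+1, k < m)
    if edge_src G (c k) == j then 1
    else if edge_tgt G (c k) == j then -1 else 0.

Definition incidence (R : realType) (m : nat) (c : 'I_m -> edge) : 'M[R]_(nv, m) :=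
  row' (ground G) (full_incidence R c).

End Circuit.

Definition passive {R : realType} {nC nR nL : nat}
    (q : 'cV[R]_nC -> 'cV[R]_nC) (phi : 'cV[R]_nL -> 'cV[R]_nL)
    (g : 'cV[R]_nR -> 'cV[R]_nR) : Prop :=
  [/\ [/\ bijective q, C1_map q &
          forall x, (jac q x)^T = jac q x /\ posdef (jac q x)],
      [/\ bijective phi, C1_map phi &
          forall x, (jac phi x)^T = jac phi x /\ posdef (jac phi x)]
    & C1_map g /\ forall x, posdef (jac g x + (jac g x)^T)].

Definition is_energy {R : realType} {n : nat} (f : 'cV[R]_n -> 'cV[R]_n)
    (V : 'cV[R]_n -> R) : Prop :=
  [/\ C2_fun V, strictly_convex V, forall y, grad V y = inv_map f y
    & exists x0, forall x, 0 < V x <-> x != x0].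

Section Blocks.
Variables (R : realType).

Definition row4 {m n1 n2 n3 n4}
    (a : 'M[R]_(m, n1)) (b : 'M[R]_(m, n2)) (c : 'M[R]_(m, n3)) (d : 'M[R]_(m, n4)) :
    'M[R]_(m, n1 + (n2 + (n3 + n4))) :=
  row_mx a (row_mx b (row_mx c d)).

Definition col4 {m1 m2 m3 m4 n}
    (a : 'M[R]_(m1, n)) (b : 'M[R]_(m2, n)) (c : 'M[R]_(m3, n)) (d : 'M[R]_(m4, n)) :
    'M[R]_(m1 + (m2 + (m3 + m4)), n) :=
  col_mx a (col_mx b (col_mx c d)).

Definition row5 {m n1 n2 n3 n4 n5} (a : 'M[R]_(m, n1)) (b : 'M[R]_(m, n2))
    (c : 'M[R]_(m, n3)) (d : 'M[R]_(m, n4)) (e : 'M[R]_(m, n5)) :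
    'M[R]_(m, n1 + (n2 + (n3 + (n4 + n5)))) :=
  row_mx a (row4 b c d e).

Definition col5 {m1 m2 m3 m4 m5 n} (a : 'M[R]_(m1, n)) (b : 'M[R]_(m2, n))
    (c : 'M[R]_(m3, n)) (d : 'M[R]_(m4, n)) (e : 'M[R]_(m5, n)) :
    'M[R]_(m1 + (m2 + (m3 + (m4 + m5))), n) :=
  col_mx a (col4 b c d e).

(* [on4 f] is the function of a block vector given by [f] on its blocks. *)
Definition on4 {T : Type} {m1 m2 m3 m4}
    (f : 'cV[R]_m1 -> 'cV[R]_m2 -> 'cV[R]_m3 -> 'cV[R]_m4 -> T)
    (x : 'cV[R]_(m1 + (m2 + (m3 + m4)))) : T :=
  f (usubmx x) (usubmx (dsubmx x))
    (usubmx (dsubmx (dsubmx x))) (dsubmx (dsubmx (dsubmx x))).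

Definition on5 {T : Type} {m1 m2 m3 m4 m5}
    (f : 'cV[R]_m1 -> 'cV[R]_m2 -> 'cV[R]_m3 -> 'cV[R]_m4 -> 'cV[R]_m5 -> T)
    (x : 'cV[R]_(m1 + (m2 + (m3 + (m4 + m5))))) : T :=
  on4 (f (usubmx x)) (dsubmx x).

End Blocks.

Section Models.
Variables (R : realType) (nv nC nR nL nV nI : nat).
Variable G : circuit nv nC nR nL nV nI.
Variables (q : 'cV[R]_nC -> 'cV[R]_nC) (phi : 'cV[R]_nL -> 'cV[R]_nL)
          (g : 'cV[R]_nR -> 'cV[R]_nR).
Variables (VC : 'cV[R]_nC -> R) (VL : 'cV[R]_nL -> R).

Local Notation AC := (incidence G R (@edgeC nC nR nL nV nI)).
Local Notation AR := (incidence G R (@edgeR nC nR nL nV nI)).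
Local Notation AL := (incidence G R (@edgeL nC nR nL nV nI)).
Local Notation AV := (incidence G R (@edgeV nC nR nL nV nI)).
Local Notation AI := (incidence G R (@edgeI nC nR nL nV nI)).
Local Notation qinv := (inv_map q).
Local Notation phiinv := (inv_map phi).

Definition E_a : 'M[R]_(nv + (nL + (nC + nV)), nC + (nL + (nv + nV))) :=
  col4 (row4 AC 0    0 0)
       (row4 0  1%:M 0 0)
       (row4 0  0    0 0)
       (row4 0  0    0 0).

Definition J_a : 'M[R]_(nv + (nL + (nC + nV))) :=
  col4 (row4 0    (- AL) 0 (- AV))
       (row4 AL^T 0      0 0)
       (row4 0    0      0 0)
       (row4 AV^T 0      0 0).

Definition B_a : 'M[R]_(nv + (nL + (nC + nV)), nI + nV) :=
  col4 (row_mx (- AI) 0)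
       (row_mx 0      0)
       (row_mx 0      0)
       (row_mx 0      (- 1%:M)).

Definition z_a : 'cV[R]_(nC + (nL + (nv + nV))) -> 'cV[R]_(nv + (nL + (nC + nV))) :=
  on4 (fun qC phiL e jV => col4 e (phiinv phiL) (qinv qC) jV).

Definition r_a : 'cV[R]_(nv + (nL + (nC + nV))) -> 'cV[R]_(nv + (nL + (nC + nV))) :=
  on4 (fun e jL uC jV => col4 (AR *m g (AR^T *m e)) 0 (AC^T *m e - uC) 0).

Definition V_a : set 'cV[R]_(nv + (nL + (nC + nV))) :=
  [set w | exists e jL uC jV, w = col4 e jL uC jV /\ AC^T *m e = uC].

Definition H_a : 'cV[R]_(nC + (nL + (nv + nV))) -> R :=
  on4 (fun qC phiL e jV => VC qC + VL phiL).

Definition model_a (I : set R) (i : R -> 'cV[R]_nI) (v : R -> 'cV[R]_nV)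
    (qC : R -> 'cV[R]_nC) (phiL : R -> 'cV[R]_nL)
    (e : R -> 'cV[R]_nv) (jV : R -> 'cV[R]_nV) (y : R -> 'cV[R]_(nI + nV)) : Prop :=
  (forall t, I t ->
     has_deriv_on I (fun s => E_a *m col4 (qC s) (phiL s) (e s) (jV s)) t
       (J_a *m col4 (e t) (phiinv (phiL t)) (qinv (qC t)) (jV t)
        - col4 (AR *m g (AR^T *m e t)) 0 (AC^T *m e t - qinv (qC t)) 0
        + B_a *m col_mx (i t) (v t))) /\
  (forall t, I t -> y t = col_mx (- (AI^T *m e t)) (- jV t)).

Definition E_b of circuit nv nC nR nL nV nI :
    'M[R]_(nv + (nC + (nC + (nL + nV))), nv + (nC + (nC + (nL + nV)))) :=
  col5 (row5 0 0 0    0    0)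
       (row5 0 0 0    0    0)
       (row5 0 0 1%:M 0    0)
       (row5 0 0 0    1%:M 0)
       (row5 0 0 0    0    0).

Definition J_b : 'M[R]_(nv + (nC + (nC + (nL + nV)))) :=
  col5 (row5 0    (- AC) 0        (- AL) (- AV))
       (row5 AC^T 0      (- 1%:M) 0      0)
       (row5 0    1%:M   0        0      0)
       (row5 AL^T 0      0        0      0)
       (row5 AV^T 0      0        0      0).

Definition B_b : 'M[R]_(nv + (nC + (nC + (nL + nV))), nI + nV) :=
  col5 (row_mx (- AI) 0)
       (row_mx 0      0)
       (row_mx 0      0)
       (row_mx 0      0)
       (row_mx 0      (- 1%:M)).

Definition z_b :
    'cV[R]_(nv + (nC + (nC + (nL + nV)))) -> 'cV[R]_(nv + (nC + (nC + (nL + nV)))) :=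
  on5 (fun e jC qC phiL jV => col5 e jC (qinv qC) (phiinv phiL) jV).

Definition r_b :
    'cV[R]_(nv + (nC + (nC + (nL + nV)))) -> 'cV[R]_(nv + (nC + (nC + (nL + nV)))) :=
  on5 (fun e jC uC jL jV => col5 (AR *m g (AR^T *m e)) 0 0 0 0).

Definition V_b of circuit nv nC nR nL nV nI : set 'cV[R]_(nv + (nC + (nC + (nL + nV)))) := setT.

Definition H_b : 'cV[R]_(nv + (nC + (nC + (nL + nV)))) -> R :=
  on5 (fun e jC qC phiL jV => VC qC + VL phiL).

Definition model_b (I : set R) (i : R -> 'cV[R]_nI) (v : R -> 'cV[R]_nV)
    (e : R -> 'cV[R]_nv) (jC : R -> 'cV[R]_nC)
    (qC : R -> 'cV[R]_nC) (phiL : R -> 'cV[R]_nL)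
    (jV : R -> 'cV[R]_nV) (y : R -> 'cV[R]_(nI + nV)) : Prop :=
  (forall t, I t ->
     has_deriv_on I (fun s => E_b G *m col5 (e s) (jC s) (qC s) (phiL s) (jV s)) t
       (J_b *m col5 (e t) (jC t) (qinv (qC t)) (phiinv (phiL t)) (jV t)
        - col5 (AR *m g (AR^T *m e t)) 0 0 0 0
        + B_b *m col_mx (i t) (v t))) /\
  (forall t, I t -> y t = col_mx (- (AI^T *m e t)) (- jV t)).

End Models.

Arguments E_a R {nv nC nR nL nV nI} G.
Arguments J_a R {nv nC nR nL nV nI} G.
Arguments B_a R {nv nC nR nL nV nI} G.
Arguments V_a R {nv nC nR nL nV nI} G.
Arguments E_b R {nv nC nR nL nV nI} G.
Arguments J_b R {nv nC nR nL nV nI} G.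
Arguments B_b R {nv nC nR nL nV nI} G.
Arguments V_b R {nv nC nR nL nV nI} G.

(* Main.v *)
(* The matrices J are skew-symmetric and the gradient condition is a blockwise
   computation.  Dissipativity reduces to w^T g(w) >= 0 with w = A_R^T e: since
   g(0) = 0, the mean value theorem along s |-> w^T g(s w) gives
   w^T g(w) = w^T g'(c w) w, which is positive for w <> 0.  In (a), the block
   row of E belonging to A_C^T e - u_C vanishes, so its derivative along a
   solution is 0; as one-sided limits on a nondegenerate interval are unique,
   the equation forces A_C^T e = u_C. *)
Require Import Defs.
From HB Require Import structures.
From mathcomp Require Import all_boot all_order all_algebra.
From mathcomp Require Import all_classical all_reals all_analysis.
From mathcomp Require Import lra.
Set Implicit Arguments.
Unset Strict Implicit.
Unset Printing Implicit Defensive.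
Local Open Scope classical_set_scope.
Local Open Scope ring_scope.

(** * Continuity of matrix-valued maps and of block projections *)

(** A basic neighbourhood of a matrix is a product of neighbourhoods of its entries, and a filter is
    stable under the finite intersection over all entries. *)
Lemma mx_continuous (R : realType) (T : topologicalType) (m n : nat)
    (f : T -> 'M[R]_(m, n)) :
  (forall i j, continuous (fun x => f x i j)) -> continuous f.
Proof.
move=> fc x A [P PA sPA].
have : \forall y \near x, forall i j, P i j (f y i j).
  apply: filter_forall => i; apply: filter_forall => j.
  by apply: (fc i j x); apply: PA.
by apply: filterS => y Py; apply: sPA.
Qed.

Lemma usubmx_continuous (R : realType) (m1 m2 n : nat) :
  continuous (usubmx : 'M[R]_(m1 + m2, n) -> 'M[R]_(m1, n)).
Proof.
apply: mx_continuous => i j x.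
under eq_fun do rewrite mxE.
exact: coord_continuous.
Qed.

Lemma dsubmx_continuous (R : realType) (m1 m2 n : nat) :
  continuous (dsubmx : 'M[R]_(m1 + m2, n) -> 'M[R]_(m2, n)).
Proof.
apply: mx_continuous => i j x.
under eq_fun do rewrite mxE.
exact: coord_continuous.
Qed.

Lemma col_mx_continuous (R : realType) (T : topologicalType) (m1 m2 n : nat)
    (f : T -> 'M[R]_(m1, n)) (g : T -> 'M[R]_(m2, n)) :
  continuous f -> continuous g -> continuous (fun x => col_mx (f x) (g x)).
Proof.
move=> fc gc; apply: mx_continuous => i j.
case: (split_ordP i) => k ->.
  under eq_fun do rewrite col_mxEu.
  move=> x; apply: (@continuous_comp _ _ _ f (fun A => A k j)); first exact: fc.
  exact: coord_continuous.
under eq_fun do rewrite col_mxEd.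
move=> x; apply: (@continuous_comp _ _ _ g (fun A => A k j)); first exact: gc.
  exact: coord_continuous.
Qed.

(** * Gradients and C1 functions under block projections *)

(** The two difference quotients coincide before any limit is taken, so the identity holds for
    arbitrary [f]. *)
Lemma derive_comp_linear (R : realType) (U V W : normedModType R)
    (f : V -> W) (p : {linear U -> V}) (x v : U) :
  'D_v (f \o p) x = 'D_(p v) f (p x).
Proof.
rewrite /derive.
by under eq_fun => h do rewrite /shift /= (linearP p h v x).
Qed.

(** The projection maps a basis vector of the upper block to a basis vector and one of the lower
    block to 0, and the derivative in direction 0 vanishes. *)
Lemma grad_usubmx (R : realType) (m n : nat) (f : 'cV[R]_m -> R)
    (x : 'cV[R]_(m + n)) :
  grad (f \o usubmx) x = col_mx (grad f (usubmx x)) 0.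
Proof.
apply/colP => k; rewrite mxE (derive_comp_linear (f : _ -> R^o)) /=.
case: (split_ordP k) => j ->.
  rewrite col_mxEu mxE; congr ('D_ _ _ _); apply/colP => i.
  by rewrite !mxE eq_lshift.
have -> : usubmx (delta_mx (rshift m j) 0 : 'cV[R]_(m + n)) = 0.
  by apply/colP => i; rewrite !mxE eq_lrshift.
by rewrite derive0 col_mxEd mxE.
Qed.

Lemma grad_dsubmx (R : realType) (m n : nat) (f : 'cV[R]_n -> R)
    (x : 'cV[R]_(m + n)) :
  grad (f \o dsubmx) x = col_mx 0 (grad f (dsubmx x)).
Proof.
apply/colP => k; rewrite mxE (derive_comp_linear (f : _ -> R^o)) /=.
case: (split_ordP k) => j ->.
  have -> : dsubmx (delta_mx (lshift n j) 0 : 'cV[R]_(m + n)) = 0.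
    by apply/colP => i; rewrite !mxE eq_rlshift.
  by rewrite derive0 col_mxEu mxE.
rewrite col_mxEd mxE; congr ('D_ _ _ _); apply/colP => i.
by rewrite !mxE eq_rshift.
Qed.

Lemma gradD (R : realType) (n : nat) (f h : 'cV[R]_n -> R) :
  C1_fun f -> C1_fun h -> grad (f + h) = grad f + grad h.
Proof.
move=> [fd _] [hd _]; apply/funext => x; apply/colP => j.
by rewrite !mxE (@deriveD _ _ R^o) //; apply: diff_derivable.
Qed.

Lemma C1_funD (R : realType) (n : nat) (f h : 'cV[R]_n -> R) :
  C1_fun f -> C1_fun h -> C1_fun (f + h).
Proof.
move=> f1 h1; split; last first.
  rewrite gradD//; case: f1 h1 => _ fc [_ hc] x.
  by apply: continuousD; [exact: fc|exact: hc].
case: f1 h1 => fd _ [hd _] x.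
by apply: (@differentiableD _ _ R^o f h x); [exact: fd|exact: hd].
Qed.

Lemma C1_fun_usubmx (R : realType) (m n : nat) (f : 'cV[R]_m -> R) :
  C1_fun f -> C1_fun (f \o usubmx : 'cV[R]_(m + n) -> R).
Proof.
move=> [fd fc]; split=> [x|].
  apply: differentiable_comp; last exact: fd.
  by apply: linear_differentiable; exact: usubmx_continuous.
rewrite (funext (grad_usubmx _)).
apply: col_mx_continuous => x; last exact: cst_continuous.
by apply: continuous_comp; [exact: usubmx_continuous|exact: fc].
Qed.

Lemma C1_fun_dsubmx (R : realType) (m n : nat) (f : 'cV[R]_n -> R) :
  C1_fun f -> C1_fun (f \o dsubmx : 'cV[R]_(m + n) -> R).
Proof.
move=> [fd fc]; split=> [x|].
  apply: differentiable_comp; last exact: fd.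
  by apply: linear_differentiable; exact: dsubmx_continuous.
rewrite (funext (grad_dsubmx _)).
apply: col_mx_continuous => x; first exact: cst_continuous.
by apply: continuous_comp; [exact: dsubmx_continuous|exact: fc].
Qed.

(** * Jacobians, quadratic forms and dissipativity *)

(** Expanding [v] in the canonical basis and using linearity of the differential leaves the
    directional derivatives that form the columns of [jac f x]. *)
Lemma diff_jac (R : realType) (m n : nat) (f : 'cV[R]_n -> 'cV[R]_m)
    (x v : 'cV[R]_n) :
  differentiable f x -> 'd f x v = jac f x *m v.
Proof.
move=> fd; apply/colP => i; rewrite mxE.
rewrite [in LHS](matrix_sum_delta v) linear_sum summxE.
apply: eq_bigr => j _; rewrite big_ord1 linearZ/= !mxE deriveE//.
by rewrite mulrC.
Qed.

Lemma trmx_quad (R : comNzRingType) (n : nat) (M : 'M[R]_n) (v w : 'cV[R]_n) :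
  v^T *m M^T *m w = (w^T *m M *m v)^T.
Proof. by rewrite !trmx_mul trmxK mulmxA. Qed.

Lemma skew_form (R : comNzRingType) (n : nat) (M : 'M[R]_n) (v w : 'cV[R]_n) :
  M^T = - M -> v^T *m M *m w = - (w^T *m M *m v).
Proof.
move=> Mskew; rewrite -mulNmx -mulmxN -Mskew trmx_quad.
(* A 1 by 1 matrix equals its transpose. *)
by apply/matrixP => i j; rewrite [RHS]mxE !ord1.
Qed.

(** The value at 0 matters: on the real line, [u - 1] has derivative 1, but [u * (u - 1)] is
    negative for [0 < u < 1]. *)
Lemma posdef_jac_dot_ge0 (R : realType) (n : nat) (g : 'cV[R]_n -> 'cV[R]_n) :
  g 0 = 0 -> (forall x, differentiable g x) ->
  (forall x, posdef (jac g x + (jac g x)^T)) ->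
  forall u, 0 <= (u^T *m g u) 0 0.
Proof.
move=> g0 gd gpos u.
have [->|u0] := eqVneq u 0; first by rewrite g0 mulmx0 mxE.
(* The pairing with [u] is packed as a linear map into [R^o], so that the chain rule for
   differentials applies to it. *)
pose L0 (w : 'cV[R]_n) : R^o := (u^T *m w) 0 0.
have L0lin : linear L0 by move=> k a b; rewrite /L0 mulmxDr -scalemxAr !mxE.
pose L : {linear 'cV[R]_n -> R^o} :=
  HB.pack L0 (GRing.isLinear.Build _ _ _ _ L0 L0lin).
have Lc : continuous L.
  have -> : (L : _ -> _) = \sum_i (fun w : 'cV[R]_n => u i 0 *: (w i 0 : R^o)).
    apply/funext => w; rewrite fct_sumE /= /L0 mxE.
    by apply: eq_bigr => i _; rewrite mxE.
  move=> w; apply: differentiable_continuous; apply: differentiable_sum => i.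
  apply: differentiableZ; exact: differentiable_coord.
(* [h s] is [u^T g(s u)]; the differential of [s |-> s u] sends 1 to [u], which gives the derivative
   [u^T g'(s u) u]. *)
pose h : R -> R^o := L \o (g \o ( *:%R^~ u)).
have hdrv (s : R) : is_derive s 1 h ((u^T *m jac g (s *: u) *m u) 0 0).
  have sd : differentiable ( *:%R^~ u : R -> 'cV[R]_n) s by exact: ex_diff.
  have gsd : differentiable (g \o *:%R^~ u : R -> 'cV[R]_n) s.
    exact: differentiable_comp.
  have hd : differentiable h s.
    by apply: differentiable_comp => //; exact: linear_differentiable.
  apply: DeriveDef; first exact: diff_derivable.
  rewrite deriveE// diff_comp//; last exact: linear_differentiable.
  rewrite diff_lin// diff_comp// /= diff_val scale1r diff_jac// /L0.
  by rewrite mulmxA.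
have h1c : {within `[0, 1], continuous h}.
  apply: continuous_subspaceT => s; apply: differentiable_continuous.
  by apply/derivable1_diffP; case: (hdrv s).
have [c _] := MVT ltr01 (fun s _ => hdrv s) h1c.
rewrite /h /= scale1r scale0r g0 /L0 mulmx0 [X in _ - X]mxE !subr0 mulr1 => ->.
(* A matrix and its transpose have the same quadratic form, so the positive quantity is twice
   [u^T g'(c u) u]. *)
have := gpos (c *: u) u u0; rewrite mulmxDr mulmxDl mxE.
by rewrite trmx_quad [X in _ + X]mxE -mulr2n pmulrn_lgt0// => /ltW.
Qed.

(** * One-sided derivatives on intervals *)

(** A nondegenerate interval contains a point [c] other than [t], hence the whole segment from [t]
    to [c], so [t] is not isolated in [I]. Properness makes limits along this filter unique. *)
Lemma time_interval_proper (R : realType) (I : set R) (t : R) :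
  time_interval I -> I t -> ProperFilter (within I t^').
Proof.
move=> [Iint [a [b [Ia Ib ab]]]] It.
have [c Ic ct] : exists2 c, I c & c - t != 0.
  have [at0|?] := eqVneq a t; last by exists a; rewrite // subr_eq0.
  by exists b => //; rewrite -at0 subr_eq0 gt_eqF.
apply: Build_ProperFilter_ex => A At.
(* The segment is parametrised from [t] towards [c], and the parameter tends to 0 from the right. *)
have pt : t + k * (c - t) @[k --> 0^'+] --> t.
  suff : t + k * (c - t) @[k --> 0^'+] --> t + 0 * (c - t).
    by rewrite mul0r addr0.
  apply: cvg_at_right_filter; apply: cvgD; first exact: cvg_cst.
  by apply: cvgM; [exact: cvg_id|exact: cvg_cst].
have Ak : \forall k \near 0^'+,
    t + k * (c - t) != t -> I (t + k * (c - t)) -> A (t + k * (c - t)).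
  exact: (pt _ At).
(* Positivity of [k] keeps the point away from [t]; [k < 1] keeps it between [t] and [c], hence in
   [I]. *)
have [k [/= {}Ak [k0 k1]]] := filter_ex (filterI Ak
  (filterI (nbhs_right_gt (0 : R)) (nbhs_right_lt ltr01))).
exists (t + k * (c - t)); apply: Ak.
  by rewrite -subr_eq0 addrC addKr mulf_neq0// gt_eqF.
have [tc|tc] := lerP t c.
  by apply: (Iint t c) => //; apply/andP; split; nra.
by apply: (Iint c t) => //; apply/andP; split; nra.
Qed.

(** [L] commutes with difference quotients, whose images are therefore constantly 0, and continuity
    carries this to the limit. Applied to a vanishing block row of [E], this extracts an algebraic
    equation from the DAE. *)
Lemma has_deriv_on_linear0 (R : realType) (p k : nat) (I : set R)
    (f : R -> 'cV[R]_p) (t : R) (l : 'cV[R]_p)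
    (L : {linear 'cV[R]_p -> 'cV[R]_k}) :
  time_interval I -> I t -> continuous L -> (forall s, L (f s) = 0) ->
  has_deriv_on I f t l -> L l = 0.
Proof.
move=> Iint It Lc Lf fl.
have Fp := time_interval_proper Iint It.
have L0 : (fun s => L ((s - t)^-1 *: (f s - f t))) = cst 0.
  by apply/funext => s; rewrite linearZ linearB/= !Lf subrr scaler0.
apply: (@cvg_unique _ _ (L ((s - t)^-1 *: (f s - f t)) @[s --> within I t^'])).
- exact: norm_hausdorff.
- exact: (continuous_cvg _ (Lc l) fl).
- by rewrite L0; exact: cvg_cst.
Qed.

(** * Calculus of block vectors and block matrices *)

Lemma on4_col4 (R : realType) (T : Type) (m1 m2 m3 m4 : nat)
    (f : 'cV[R]_m1 -> 'cV[R]_m2 -> 'cV[R]_m3 -> 'cV[R]_m4 -> T) a b c d :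
  on4 f (col4 a b c d) = f a b c d.
Proof. by rewrite /on4 /col4 !(col_mxKu, col_mxKd). Qed.

Lemma on5_col5 (R : realType) (T : Type) (m1 m2 m3 m4 m5 : nat)
    (f : 'cV[R]_m1 -> 'cV[R]_m2 -> 'cV[R]_m3 -> 'cV[R]_m4 -> 'cV[R]_m5 -> T)
    a b c d e :
  on5 f (col5 a b c d e) = f a b c d e.
Proof. by rewrite /on5 /col5 col_mxKu col_mxKd on4_col4. Qed.

Lemma col4P (R : realType) (m1 m2 m3 m4 : nat)
    (w : 'cV[R]_(m1 + (m2 + (m3 + m4)))) :
  exists a b c d, w = col4 a b c d.
Proof.
exists (usubmx w), (usubmx (dsubmx w)), (usubmx (dsubmx (dsubmx w))),
  (dsubmx (dsubmx (dsubmx w))).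
by rewrite /col4 !vsubmxK.
Qed.

Lemma col5P (R : realType) (m1 m2 m3 m4 m5 : nat)
    (w : 'cV[R]_(m1 + (m2 + (m3 + (m4 + m5))))) :
  exists a b c d e, w = col5 a b c d e.
Proof.
have [b [c [d [e we]]]] := col4P (dsubmx w).
by exists (usubmx w), b, c, d, e; rewrite /col5 -we vsubmxK.
Qed.

Lemma mul_col4 (R : realType) (m1 m2 m3 m4 n p : nat) (a : 'M[R]_(m1, n))
    (b : 'M[R]_(m2, n)) (c : 'M[R]_(m3, n)) (d : 'M[R]_(m4, n))
    (M : 'M[R]_(n, p)) :
  col4 a b c d *m M = col4 (a *m M) (b *m M) (c *m M) (d *m M).
Proof. by rewrite /col4 !mul_col_mx. Qed.

Lemma mul_row4_col4 (R : realType) (m n1 n2 n3 n4 p : nat)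
    (a : 'M[R]_(m, n1)) (b : 'M[R]_(m, n2)) (c : 'M[R]_(m, n3))
    (d : 'M[R]_(m, n4)) (a' : 'M[R]_(n1, p)) (b' : 'M[R]_(n2, p))
    (c' : 'M[R]_(n3, p)) (d' : 'M[R]_(n4, p)) :
  row4 a b c d *m col4 a' b' c' d' =
  a *m a' + (b *m b' + (c *m c' + d *m d')).
Proof. by rewrite /row4 /col4 !mul_row_col. Qed.

Lemma tr_col4 (R : realType) (m1 m2 m3 m4 n : nat) (a : 'M[R]_(m1, n))
    (b : 'M[R]_(m2, n)) (c : 'M[R]_(m3, n)) (d : 'M[R]_(m4, n)) :
  (col4 a b c d)^T = row4 a^T b^T c^T d^T.
Proof. by rewrite /col4 !tr_col_mx. Qed.

Lemma tr_row4 (R : realType) (m n1 n2 n3 n4 : nat)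
    (a : 'M[R]_(m, n1)) (b : 'M[R]_(m, n2)) (c : 'M[R]_(m, n3))
    (d : 'M[R]_(m, n4)) :
  (row4 a b c d)^T = col4 a^T b^T c^T d^T.
Proof. by rewrite /row4 !tr_row_mx. Qed.

Lemma mul_col5 (R : realType) (m1 m2 m3 m4 m5 n p : nat) (a : 'M[R]_(m1, n))
    (b : 'M[R]_(m2, n)) (c : 'M[R]_(m3, n)) (d : 'M[R]_(m4, n))
    (e : 'M[R]_(m5, n)) (M : 'M[R]_(n, p)) :
  col5 a b c d e *m M =
  col5 (a *m M) (b *m M) (c *m M) (d *m M) (e *m M).
Proof. by rewrite /col5 mul_col_mx mul_col4. Qed.

Lemma mul_row5_col5 (R : realType) (m n1 n2 n3 n4 n5 p : nat)
    (a : 'M[R]_(m, n1)) (b : 'M[R]_(m, n2)) (c : 'M[R]_(m, n3))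
    (d : 'M[R]_(m, n4)) (e : 'M[R]_(m, n5)) (a' : 'M[R]_(n1, p))
    (b' : 'M[R]_(n2, p)) (c' : 'M[R]_(n3, p)) (d' : 'M[R]_(n4, p))
    (e' : 'M[R]_(n5, p)) :
  row5 a b c d e *m col5 a' b' c' d' e' =
  a *m a' + (b *m b' + (c *m c' + (d *m d' + e *m e'))).
Proof. by rewrite /row5 /col5 mul_row_col mul_row4_col4. Qed.

Lemma tr_col5 (R : realType) (m1 m2 m3 m4 m5 n : nat) (a : 'M[R]_(m1, n))
    (b : 'M[R]_(m2, n)) (c : 'M[R]_(m3, n)) (d : 'M[R]_(m4, n))
    (e : 'M[R]_(m5, n)) :
  (col5 a b c d e)^T = row5 a^T b^T c^T d^T e^T.
Proof. by rewrite /col5 tr_col_mx tr_col4. Qed.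

Lemma tr_row5 (R : realType) (m n1 n2 n3 n4 n5 : nat)
    (a : 'M[R]_(m, n1)) (b : 'M[R]_(m, n2)) (c : 'M[R]_(m, n3))
    (d : 'M[R]_(m, n4)) (e : 'M[R]_(m, n5)) :
  (row5 a b c d e)^T = col5 a^T b^T c^T d^T e^T.
Proof. by rewrite /row5 tr_row_mx tr_row4. Qed.

(** Transposition turns a column of rows into a row of columns; this exchange restores the original
    nesting, so that blocks can be compared. *)
Lemma row_mx_col_mx (R : realType) (m1 m2 n1 n2 : nat) (a : 'M[R]_(m1, n1))
    (b : 'M[R]_(m2, n1)) (c : 'M[R]_(m1, n2)) (d : 'M[R]_(m2, n2)) :
  row_mx (col_mx a b) (col_mx c d) = col_mx (row_mx a c) (row_mx b d).
Proof. by rewrite -block_mxEh block_mxEv. Qed.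

(** * Port-Hamiltonian structure of the two circuit models *)

Section PortHamiltonian.
Variables (R : realType) (nv nC nR nL nV nI : nat).
Variable G : circuit nv nC nR nL nV nI.
Variables (q : 'cV[R]_nC -> 'cV[R]_nC) (phi : 'cV[R]_nL -> 'cV[R]_nL).
Variable g : 'cV[R]_nR -> 'cV[R]_nR.
Variables (VC : 'cV[R]_nC -> R) (VL : 'cV[R]_nL -> R).
Local Notation AC := (incidence G R (@edgeC nC nR nL nV nI)).
Local Notation AR := (incidence G R (@edgeR nC nR nL nV nI)).
Local Notation AI := (incidence G R (@edgeI nC nR nL nV nI)).

(** The block decomposition is unique, so the existential witnesses in [V_a] are forced. *)
Lemma V_a_col4 e jL uC jV :
  V_a R G (col4 e jL uC jV) <-> AC^T *m e = uC.
Proof.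
split=> [|eC]; last by exists e, jL, uC, jV.
by move=> [e' [jL' [uC' [jV' [/eq_col_mx[<- /eq_col_mx[_ /eq_col_mx[<- _]]] ]]]]].
Qed.

Lemma V_a_submod_closed : GRing.submod_closed [in V_a R G].
Proof.
split=> [|k v w].
  by apply/mem_set; exists 0, 0, 0, 0; rewrite mulmx0 /col4 !col_mx0.
move=> /set_mem[e [jL [uC [jV [-> <-]]]]] /set_mem[e' [jL' [uC' [jV' [-> <-]]]]].
apply/mem_set; rewrite /col4 !scale_col_mx !add_col_mx.
by apply/V_a_col4; rewrite mulmxDr scalemxAr.
Qed.

Lemma J_a_skew : (J_a R G)^T = - J_a R G.
Proof.
rewrite /J_a tr_col4 !tr_row4 /row4 /col4 !opp_col_mx !opp_row_mx.
rewrite !trmx0 !linearN/= !trmxK !oppr0 !opprK.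
by rewrite !row_mx_col_mx.
Qed.

Lemma J_b_skew : (J_b R G)^T = - J_b R G.
Proof.
rewrite /J_b tr_col5 !tr_row5 /row5 /col5 /row4 /col4 !opp_col_mx !opp_row_mx.
rewrite !trmx0 !linearN/= !trmxK !oppr0 !opprK trmx1.
by rewrite !row_mx_col_mx.
Qed.

Lemma tr_B_a_mul (e : 'cV[R]_nv) (jL : 'cV[R]_nL) (uC : 'cV[R]_nC)
    (jV : 'cV[R]_nV) :
  (B_a R G)^T *m col4 e jL uC jV = col_mx (- (AI^T *m e)) (- jV).
Proof.
rewrite /B_a tr_col4 mul_row4_col4 !tr_row_mx !trmx0 !mul_col_mx !mul0mx.
by rewrite !add_col_mx !add0r !addr0 !linearN/= trmx1 !mulNmx mul1mx.
Qed.

Lemma tr_B_b_mul (e : 'cV[R]_nv) (jC uC : 'cV[R]_nC) (jL : 'cV[R]_nL)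
    (jV : 'cV[R]_nV) :
  (B_b R G)^T *m col5 e jC uC jL jV = col_mx (- (AI^T *m e)) (- jV).
Proof.
rewrite /B_b tr_col5 mul_row5_col5 !tr_row_mx !trmx0 !mul_col_mx !mul0mx.
by rewrite !add_col_mx !add0r !addr0 !linearN/= trmx1 !mulNmx mul1mx.
Qed.

(** On [V_a] the first block equals [uC], which is the gradient of [VC] when [uC] is [inv_map q qC];
    this is how the gradient condition uses the subspace. *)
Lemma tr_E_a_mul (e : 'cV[R]_nv) (jL : 'cV[R]_nL) (uC : 'cV[R]_nC)
    (jV : 'cV[R]_nV) :
  (E_a R G)^T *m col4 e jL uC jV = col4 (AC^T *m e) jL 0 0.
Proof.
rewrite /E_a tr_col4 mul_row4_col4 !tr_row4 !trmx0 !mul_col4 !mul0mx.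
by rewrite /col4 !add_col_mx !add0r !addr0 trmx1 mul1mx.
Qed.

Lemma tr_E_b_mul (e : 'cV[R]_nv) (jC uC : 'cV[R]_nC) (jL : 'cV[R]_nL)
    (jV : 'cV[R]_nV) :
  (E_b R G)^T *m col5 e jC uC jL jV = col5 0 0 uC jL 0.
Proof.
rewrite /E_b tr_col5 mul_row5_col5 !tr_row5 !trmx0 !mul_col5 !mul0mx.
by rewrite /col5 /col4 !add_col_mx !add0r !addr0 !trmx1 !mul1mx.
Qed.

Lemma z_a_col4 qC phiL (e : 'cV[R]_nv) (jV : 'cV[R]_nV) :
  z_a q phi (col4 qC phiL e jV) = col4 e (inv_map phi phiL) (inv_map q qC) jV.
Proof. exact: on4_col4. Qed.

Lemma r_a_col4 e (jL : 'cV[R]_nL) uC (jV : 'cV[R]_nV) :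
  r_a G g (col4 e jL uC jV) = col4 (AR *m g (AR^T *m e)) 0 (AC^T *m e - uC) 0.
Proof. exact: on4_col4. Qed.

Lemma z_b_col5 (e : 'cV[R]_nv) (jC : 'cV[R]_nC) qC phiL (jV : 'cV[R]_nV) :
  z_b q phi (col5 e jC qC phiL jV) =
  col5 e jC (inv_map q qC) (inv_map phi phiL) jV.
Proof. exact: on5_col5. Qed.

Lemma r_b_col5 e jC uC (jL : 'cV[R]_nL) (jV : 'cV[R]_nV) :
  r_b G g (col5 e jC uC jL jV) = col5 (AR *m g (AR^T *m e)) 0 0 0 0.
Proof. exact: on5_col5. Qed.

Lemma dae_solution_a_V (I : set R) u x : time_interval I ->
  dae_solution (E_a R G) (J_a R G) (B_a R G) (z_a q phi) (r_a G g) I u x ->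
  forall t, I t -> V_a R G (z_a q phi (x t)).
Proof.
move=> Iint xsol t It.
(* [L] selects the third block, the one carrying [AC^T e - uC]. *)
pose L : {linear 'cV[R]_(nv + (nL + (nC + nV))) -> 'cV[R]_nC} :=
  usubmx \o (dsubmx \o dsubmx).
have := @has_deriv_on_linear0 _ _ _ I _ t _ L Iint It _ _ (xsol t It).
have [qC [phiL [e [jV ->]]]] := col4P (x t).
have [i [v ->]] : exists i v, u t = col_mx i v.
  by exists (usubmx (u t)), (dsubmx (u t)); rewrite vsubmxK.
rewrite z_a_col4 r_a_col4 => LE.
(* The third block rows of [J_a] and [B_a] vanish, so [L] sends the right-hand side to
   [-(AC^T e - uC)]; hence the change of sign. The premises of [LE] are left as the last two
   goals. *)
apply/V_a_col4/eqP; rewrite -subr_eq0 -oppr_eq0; apply/eqP; rewrite -[RHS]LE.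
- rewrite /= /J_a /B_a !mul_col4 /col4 !opp_col_mx !add_col_mx.
  rewrite !(col_mxKu, col_mxKd) /row4 !row_mx0 !mul0mx.
  by rewrite add0r addr0.
- move=> w; apply: continuous_comp; last exact: usubmx_continuous.
  by apply: continuous_comp; exact: dsubmx_continuous.
- move=> s; rewrite /= /E_a mul_col4 /col4 !(col_mxKu, col_mxKd).
  by rewrite /row4 !row_mx0 mul0mx.
Qed.

Lemma PHDAE_a : g 0 = 0 -> passive q phi g -> is_energy q VC ->
  is_energy phi VL ->
  is_PHDAE (E_a R G) (J_a R G) (B_a R G) (z_a q phi) (r_a G g)
    (V_a R G) (H_a VC VL).
Proof.
move=> g0 [_ _ [[gd _] gpos]] [[VC1 _] _ VCq _] [[VL1 _] _ VLphi _].
(* The Hamiltonian is split into two functions of a single block each, to which the projection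
   lemmas apply. *)
pose f1 : 'cV[R]_(nC + (nL + (nv + nV))) -> R := VC \o usubmx.
pose f2 : 'cV[R]_(nC + (nL + (nv + nV))) -> R := (VL \o usubmx) \o dsubmx.
have f1C : C1_fun f1 by exact: C1_fun_usubmx.
have f2C : C1_fun f2 by apply: C1_fun_dsubmx; exact: C1_fun_usubmx.
have HE : H_a VC VL = f1 + f2 by [].
split; first by split; [exact: V_a_submod_closed|rewrite HE; exact: C1_funD].
split.
- by move=> I u x; exact: dae_solution_a_V.
- by move=> v w _ _; apply: skew_form; exact: J_a_skew.
- move=> _ [e [jL [uC [jV [-> <-]]]]].
  (* On the subspace the block [AC^T e - uC] is 0, so only the resistive term survives; it is then
     paired with [e^T AR = (AR^T e)^T]. *)
  rewrite r_a_col4 subrr tr_col4 mul_row4_col4 !mulmx0 !addr0 mulmxA.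
  by rewrite -[X in X *m _]trmxK trmx_mul trmxK; exact: posdef_jac_dot_ge0.
- move=> x; have [qC [phiL [e [jV ->]]]] := col4P x.
  rewrite z_a_col4 => /V_a_col4 eC; rewrite tr_E_a_mul eC HE gradD//.
  rewrite -[(_ + _) _]/(grad f1 _ + grad f2 _).
  rewrite grad_usubmx !grad_dsubmx grad_usubmx /col4 !(col_mxKu, col_mxKd).
  by rewrite VCq VLphi add_col_mx addr0 add0r !col_mx0.
Qed.

(** With [jC] as an unknown, the relation between [AC^T e] and [uC] is a row of the skew matrix
    [J_b]. The subspace can then be the whole space, and [r_b] contains only the resistive term. *)
Lemma PHDAE_b : g 0 = 0 -> passive q phi g -> is_energy q VC ->
  is_energy phi VL ->
  is_PHDAE (E_b R G) (J_b R G) (B_b R G) (z_b q phi) (r_b G g)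
    (V_b R G) (H_b VC VL).
Proof.
move=> g0 [_ _ [[gd _] gpos]] [[VC1 _] _ VCq _] [[VL1 _] _ VLphi _].
pose f1 : 'cV[R]_(nv + (nC + (nC + (nL + nV)))) -> R :=
  ((VC \o usubmx) \o dsubmx) \o dsubmx.
pose f2 : 'cV[R]_(nv + (nC + (nC + (nL + nV)))) -> R :=
  (((VL \o usubmx) \o dsubmx) \o dsubmx) \o dsubmx.
have f1C : C1_fun f1 by do 2!apply: C1_fun_dsubmx; exact: C1_fun_usubmx.
have f2C : C1_fun f2 by do 3!apply: C1_fun_dsubmx; exact: C1_fun_usubmx.
have HE : H_b VC VL = f1 + f2 by [].
split.
  split; last by rewrite HE; exact: C1_funD.
  by split=> [|k v w _ _]; apply/mem_set.
split=> //.
- by move=> v w _ _; apply: skew_form; exact: J_b_skew.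
- move=> w _; have [e [jC [uC [jL [jV ->]]]]] := col5P w.
  rewrite r_b_col5 tr_col5 mul_row5_col5 !mulmx0 !addr0 mulmxA.
  by rewrite -[X in X *m _]trmxK trmx_mul trmxK; exact: posdef_jac_dot_ge0.
- move=> x _; have [e [jC [qC [phiL [jV ->]]]]] := col5P x.
  rewrite z_b_col5 tr_E_b_mul HE gradD//.
  rewrite -[(_ + _) _]/(grad f1 _ + grad f2 _).
  rewrite !grad_dsubmx !grad_usubmx /col5 /col4 !(col_mxKu, col_mxKd).
  by rewrite VCq VLphi !add_col_mx !addr0 add0r.
Qed.

End PortHamiltonian.

(** * Identification of the displayed models with the abstract systems *)

Theorem proposition11 (R : realType) (nv nC nR nL nV nI : nat)
    (G : circuit nv nC nR nL nV nI)
    (q : 'cV[R]_nC -> 'cV[R]_nC) (phi : 'cV[R]_nL -> 'cV[R]_nL)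
    (g : 'cV[R]_nR -> 'cV[R]_nR)
    (VC : 'cV[R]_nC -> R) (VL : 'cV[R]_nL -> R)
    (G_sound : sound G) (qphig_passive : passive q phi g) (g0 : g 0 = 0)
    (VC_energy : is_energy q VC) (VL_energy : is_energy phi VL) :
  ((forall I i v qC phiL e jV y, time_interval I ->
      model_a G q phi g I i v qC phiL e jV y <->
      let u := fun t => col_mx (i t) (v t) in
      let x := fun t => col4 (qC t) (phiL t) (e t) (jV t) in
      dae_solution (E_a R G) (J_a R G) (B_a R G) (z_a q phi) (r_a G g) I u x /\
      dae_output (B_a R G) (z_a q phi) I x y) /\
   is_PHDAE (E_a R G) (J_a R G) (B_a R G) (z_a q phi) (r_a G g)
     (V_a R G) (H_a VC VL)) /\
  ((forall I i v e jC qC phiL jV y, time_interval I ->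
      model_b G q phi g I i v e jC qC phiL jV y <->
      let u := fun t => col_mx (i t) (v t) in
      let x := fun t => col5 (e t) (jC t) (qC t) (phiL t) (jV t) in
      dae_solution (E_b R G) (J_b R G) (B_b R G) (z_b q phi) (r_b G g) I u x /\
      dae_output (B_b R G) (z_b q phi) I x y) /\
   is_PHDAE (E_b R G) (J_b R G) (B_b R G) (z_b q phi) (r_b G g)
     (V_b R G) (H_b VC VL)).
Proof.
split; split; [|exact: PHDAE_a| |exact: PHDAE_b].
- move=> I i v qC phiL e jV y _; rewrite /model_a /dae_solution /dae_output /=.
  (* At each [t] the block forms of [z], [r] and [B^T z] turn one formulation into the other. *)
  split=> -[sol out]; split=> t It; move: (sol t It) (out t It);
    by rewrite z_a_col4 ?r_a_col4 ?tr_B_a_mul.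
- move=> I i v e jC qC phiL jV y _; rewrite /model_b /dae_solution /dae_output /=.
  split=> -[sol out]; split=> t It; move: (sol t It) (out t It);
    by rewrite z_b_col5 ?r_b_col5 ?tr_B_b_mul.
Qed.
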